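(* Let $a=(a_k)_{k\in\mathbb{N}}\in\ell^\infty$. Then the following hold. (a) If $|a|$ is Cesàro convergent (i.e. $\lim_{n\to\infty}\frac1n\sum_{k=1}^n|a_k|$ exists), then $\lim_{n\to\infty}\frac1n\sum_{k=1}^{n}|a_k|\le\|a\|_w$. (b) If $|a|$ is convergent, then $\lim_{k\to\infty}|a_k|\le\|a\|_w$. (c) If $a$ is periodic of period $N\in\mathbb{N}$, then $\overline{|a|}=\frac1N\sum_{k=1}^{N}|a_k|\le\|a\|_w$. (d) If there exist a periodic sequence $a_1\in\ell^\infty$ and a convergent sequence $a_2=(a_{2,k})_{k\in\mathbb{N}}$ such that $a=a_1+a_2$, then $\left|\overline{a_1}+\lim_{k\to\infty}a_{2,k}\right|\le\|a\|_w$.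
   Context: $\mathbb{N}=\{1,2,3,\dots\}$. $\ell^2$ is the complex Hilbert space of square-summable unilateral sequences $(x_k)_{k\in\mathbb{N}}$, and $\ell^\infty$ the complex Banach space of bounded complex sequences. For $a\in\ell^\infty$, the (unilateral) weighted forward shift $T_a:\ell^2\to\ell^2$ is the bounded operator $T_a(x_1,x_2,\dots)=(0,a_1x_1,a_2x_2,\dots)$. The numerical radius of a bounded operator $T$ on a complex Hilbert space $H$ is $w(T)=\sup\{|\langle Tx,x\rangle| : x\in H,\ \|x\|=1\}$. Set $\|a\|_w:=w(T_a)$, which is a norm on $\ell^\infty$. $|a|=(|a_k|)_{k\in\mathbb N}$. A sequence $b$ is periodic of period $N\in\mathbb{N}$ if $b_{k+N}=b_k$ for all $k\in\mathbb{N}$, and its arithmetic mean is then $\overline{b}:=\frac1N\sum_{k=1}^N b_k$. In (d), $a_1,a_2$ denote complex sequences, not entries of $a$. *)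

(* Defs.v *)
From HB Require Import structures.
From mathcomp Require Import all_boot all_order all_algebra.
From mathcomp Require Import complex.
From mathcomp Require Import all_classical all_reals all_analysis.
From mathcomp Require Import ring.
Set Implicit Arguments.
Unset Strict Implicit.
Unset Printing Implicit Defensive.
Import Order.TTheory GRing.Theory Num.Theory.
Import numFieldNormedType.Exports.
Import ComplexField Normc.
Local Open Scope classical_set_scope.
Local Open Scope ring_scope.

(* Complex numbers over R are [R[i]]; the regular module [R[i]^o] carries the
   usual topology of the complex plane and its structure of normed vector space
   over [R[i]].  [normc z : R] is the modulus of z as a real number (the generic
   norm [`|z|] is valued in [R[i]]).
   Sequences are indexed from 0: the term written [a k] here is the (k+1)-st
   term of the sequence. *)

Section ComplexSeries.
Variable R : realType.
Implicit Types (z : R[i]) (u v : nat -> R[i]^o).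

Lemma normcC z : `|z| = (normc z)%:C%C.
Proof. by []. Qed.

Lemma normc_ge0 z : 0 <= normc z.
Proof. by case: z => x y; exact: sqrtr_ge0. Qed.

Lemma normc_eq0 z : (normc z == 0) = (z == 0).
Proof.
by apply/eqP/eqP => [|->]; [exact: eq0_normc|exact: normc0].
Qed.

Lemma ler_normcD z1 z2 : normc (z1 + z2) <= normc z1 + normc z2.
Proof. exact: le_normcD. Qed.

Lemma normcJ z : normc z^* = normc z.
Proof. by case: z => x y /=; rewrite sqrrN. Qed.

Lemma mulcJ z : z * z^* = (normc z ^+ 2)%:C%C.
Proof. by rewrite -normCK normcC rmorphXn. Qed.

Lemma Re_le_normc z : `|complex.Re z| <= normc z.
Proof.
case: z => x y /=; rewrite -sqrtr_sqr ler_sqrt ?lerDl ?sqr_ge0//.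
by rewrite addr_ge0 ?sqr_ge0.
Qed.

Lemma Im_le_normc z : `|complex.Im z| <= normc z.
Proof.
case: z => x y /=; rewrite -sqrtr_sqr ler_sqrt ?lerDr ?sqr_ge0//.
by rewrite addr_ge0 ?sqr_ge0.
Qed.

Lemma normc_le_ReIm z : normc z <= `|complex.Re z| + `|complex.Im z|.
Proof.
case: z => x y /=.
rewrite -(ler_pXn2r (n := 2)) ?nnegrE ?sqrtr_ge0 ?addr_ge0//.
rewrite sqr_sqrtr ?addr_ge0 ?sqr_ge0// sqrrD !real_normK ?num_real//.
by rewrite addrAC lerDl mulrn_wge0// mulr_ge0.
Qed.

Lemma cvg_normcP u z : (u @ \oo --> (z : R[i]^o)) <->
  (forall e : R, 0 < e -> \forall n \near \oo, normc (z - u n) < e).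
Proof.
split=> [/cvgrPdist_lt uz e e0|uz].
  have e0C : (0 : R[i]) < e%:C%C by rewrite ltcR.
  by apply: filterS (uz _ e0C) => n; rewrite normcC ltcR.
apply/cvgrPdist_lt => e e0.
have eE : e = (complex.Re e)%:C%C by rewrite RRe_real// gtr0_real.
have : 0 < complex.Re e by rewrite -ltcR -eE.
move=> /uz; apply: filterS => n un.
by rewrite eE normcC ltcR.
Qed.

Lemma cvg_ReIm u (x y : R) :
    (fun n => complex.Re (u n)) @ \oo --> x ->
    (fun n => complex.Im (u n)) @ \oo --> y ->
  u @ \oo --> (Complex x y : R[i]^o).
Proof.
move=> /cvgrPdist_lt ux /cvgrPdist_lt uy; apply/cvg_normcP => e e0.
have e20 : 0 < e / 2 by rewrite divr_gt0.
near=> n.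
apply: le_lt_trans (normc_le_ReIm _) _.
have -> : complex.Re (Complex x y - u n) = x - complex.Re (u n).
  by case: (u n).
have -> : complex.Im (Complex x y - u n) = y - complex.Im (u n).
  by case: (u n).
rewrite (splitr e) ltrD//; near: n; [exact: ux|exact: uy].
Unshelve. all: by end_near. Qed.

Lemma cvg_conjc u z : u @ \oo --> (z : R[i]^o) ->
  (fun n => (u n : R[i])^* : R[i]^o) @ \oo --> (z^* : R[i]^o).
Proof.
move=> /cvg_normcP uz; apply/cvg_normcP => e /uz.
by apply: filterS => n; rewrite -rmorphB normcJ.
Qed.

Lemma Re_series u n :
  complex.Re (series u n) = series (fun k => complex.Re (u k)) n.
Proof. by rewrite !seriesEnat /=; apply: (big_morph (@complex.Re R)) => // -[? ?] []. Qed.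

Lemma Im_series u n :
  complex.Im (series u n) = series (fun k => complex.Im (u k)) n.
Proof. by rewrite !seriesEnat /=; apply: (big_morph (@complex.Im R)) => // -[? ?] []. Qed.

Lemma cvg_series_normc u :
  cvgn (series (fun k => normc (u k))) -> cvgn (series u).
Proof.
move=> cu.
have cvg_part (f : R[i] -> R) : (forall z, `|f z| <= normc z) ->
    cvgn (series (fun k => f (u k))).
  move=> fn; apply: normed_cvg.
  apply: (series_le_cvg _ _ _ cu) => n //=.
  exact: normc_ge0.
have cr := cvg_part _ Re_le_normc; have ci := cvg_part _ Im_le_normc.
apply: (@cvgP _ _ (Complex (limn (series (fun k => complex.Re (u k))))
                  (limn (series (fun k => complex.Im (u k)))) : R[i]^o)).
apply: cvg_ReIm.
- by under eq_fun do rewrite Re_series.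
- by under eq_fun do rewrite Im_series.
Qed.

End ComplexSeries.

Section Ell2.
Variable R : realType.
Implicit Types x y : nat -> R[i]^o.

Definition square_summable x : Prop := cvgn (series (fun k => normc (x k) ^+ 2)).

Definition ell2_pred : {pred nat -> R[i]^o} := fun x => `[< square_summable x >].

Lemma ell2_predP x : reflect (square_summable x) (x \in ell2_pred).
Proof. exact: asboolP. Qed.

Lemma ell2_submod_closed : GRing.submod_closed ell2_pred.
Proof.
split=> [|c x y /ell2_predP sx /ell2_predP sy]; apply/ell2_predP.
  rewrite /square_summable.
  have -> : series (fun k => normc ((0 : nat -> R[i]^o) k) ^+ 2) = cst 0.
    apply/funext => n; rewrite seriesEnat/= big1// => k _.
    by rewrite expr0n/= addr0 sqrtr0 expr0n.
  exact: is_cvg_cst.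
pose w := (2 * normc c ^+ 2) *: (fun k => normc (x k) ^+ 2)
          + 2 *: (fun k => normc (y k) ^+ 2) : nat -> R.
have wE n : w n = 2 * ((normc c * normc (x n)) ^+ 2 + normc (y n) ^+ 2).
  by rewrite exprMn mulrDr mulrA.
apply: (@series_le_cvg _ _ w) => [n|n|n|].
- exact: sqr_ge0.
- by rewrite wE mulr_ge0// addr_ge0// sqr_ge0.
- rewrite wE -normcM; set p := normc (c * x n); set q := normc (y n).
  apply: (@le_trans _ _ ((p + q) ^+ 2)).
    by rewrite ler_pXn2r ?nnegrE ?addr_ge0 ?normc_ge0// ler_normcD.
  rewrite sqrrD mulrDr !mulr_natl [leRHS]addrACA -subr_ge0.
  have -> : p ^+ 2 + q ^+ 2 + (p ^+ 2 + q ^+ 2)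
      - (p ^+ 2 + p * q *+ 2 + q ^+ 2) = (p - q) ^+ 2.
    by rewrite sqrrB; ring.
  exact: sqr_ge0.
- by rewrite /w; apply: is_cvg_seriesD; apply: is_cvg_seriesZ.
Qed.

HB.instance Definition _ := GRing.isSubmodClosed.Build R[i] (nat -> R[i]^o)
  ell2_pred ell2_submod_closed.

Record ell2 := Ell2 {
  seq_of_ell2 :> nat -> R[i]^o;
  ell2_subproof : seq_of_ell2 \in ell2_pred }.

HB.instance Definition _ := [isSub for seq_of_ell2].
HB.instance Definition _ := [Choice of ell2 by <:].
HB.instance Definition _ := [SubChoice_isSubLmodule of ell2 by <:].

Lemma ell2P (x : ell2) : square_summable x.
Proof. exact/ell2_predP/ell2_subproof. Qed.
Arguments ell2P : clear implicits.

Definition ell2_dot (x y : ell2) : R[i] :=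
  limn (series (fun k => (x k : R[i]) * (y k : R[i])^* : R[i]^o)).

Lemma is_cvg_ell2_dot (x y : ell2) :
  cvgn (series (fun k => (x k : R[i]) * (y k : R[i])^* : R[i]^o)).
Proof.
apply: cvg_series_normc.
pose w := (fun k => normc (x k) ^+ 2) + (fun k => normc (y k) ^+ 2) : nat -> R.
apply: (@series_le_cvg _ _ w) => [n|n|n|].
- exact: normc_ge0.
- by apply: addr_ge0; exact: sqr_ge0.
- rewrite normcM normcJ; have -> : w n = normc (x n) ^+ 2 + normc (y n) ^+ 2 by [].
  have p0 := normc_ge0 (x n); have q0 := normc_ge0 (y n).
  have pq : 0 <= (normc (x n) - normc (y n)) ^+ 2 by exact: sqr_ge0.
  have pq0 : 0 <= normc (x n) * normc (y n) by exact: mulr_ge0.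
  rewrite -subr_ge0; apply: (le_trans (addr_ge0 pq pq0)).
  by rewrite le_eqVlt; apply/orP; left; apply/eqP; ring.
- by rewrite /w; apply: is_cvg_seriesD; exact: ell2P.
Qed.

Fact ell2_dot_linearl (y : ell2) : linear_for *%R (ell2_dot ^~ y).
Proof.
move=> c x z; rewrite /ell2_dot.
have cx := @is_cvg_ell2_dot x y; have cz := @is_cvg_ell2_dot z y.
have := cvgD (cvgZl_tmp (k := c) cx) cz; set l := (X in _ --> X).
move=> /(_ _ _) xzl; rewrite -[RHS]/(l : R[i]^o).
apply: (@cvg_lim R[i]^o); first exact: norm_hausdorff.
move: xzl; apply: cvg_trans; apply: near_eq_cvg; near=> n.
rewrite -[LHS]/(c *: series _ n + series _ n) !seriesEnat/=.
rewrite scaler_sumr -big_split/=; apply: eq_bigr => k _.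
by rewrite [RHS]mulrDl -mulrA.
Unshelve. all: by end_near. Qed.

Fact ell2_dot_conj (x y : ell2) : ell2_dot x y = (ell2_dot y x)^*.
Proof.
rewrite /ell2_dot; apply: (@cvg_lim R[i]^o); first exact: norm_hausdorff.
have := cvg_conjc (@is_cvg_ell2_dot y x); apply: cvg_trans.
apply: near_eq_cvg; near=> n.
rewrite !seriesEnat /= rmorph_sum; apply: eq_bigr => k _.
by rewrite rmorphM/= conjCK mulrC.
Unshelve. all: by end_near. Qed.

Fact ell2_dot_gt0 (x : ell2) : x != 0 -> 0 < ell2_dot x x.
Proof.
move=> x0.
have -> : ell2_dot x x = (limn (series (fun k => normc (x k) ^+ 2)))%:C%C.
  apply: (@cvg_lim R[i]^o); first exact: norm_hausdorff.
  apply: cvg_ReIm.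
    have := ell2P x; apply: cvg_trans; apply: near_eq_cvg; near=> n.
    rewrite Re_series; congr (series _ n); apply/funext => k.
    by rewrite mulcJ.
  apply: cvg_near_cst; near=> n.
  rewrite Im_series seriesEnat/= big1// => k _; by rewrite mulcJ.
rewrite ltcR.
have [k xk0] : exists k, x k != 0.
  apply/not_existsP => xk; move/eqP: x0; apply; apply/val_inj/funext => k /=.
  by apply/eqP/negPn/negP; exact: xk.
apply: (@lt_le_trans _ _ (series (fun k => normc (x k) ^+ 2) k.+1)).
  rewrite seriesEnat/= big_nat_recr//=; apply: ltr_wpDl.
    by apply: sumr_ge0 => i _; exact: sqr_ge0.
  by rewrite exprn_gt0// lt_def normc_ge0 normc_eq0 xk0.
apply: nondecreasing_cvgn_le (ell2P x) _.
apply: nondecreasing_series => i _ _; exact: sqr_ge0.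
Unshelve. all: by end_near. Qed.

Fact ell2_dot_linearr (x : ell2) : linear_for (Num.conj \; *%R) (ell2_dot x).
Proof.
move=> c y z; rewrite ell2_dot_conj ell2_dot_linearl rmorphD rmorphM/=.
by rewrite -!ell2_dot_conj.
Qed.

HB.instance Definition _ := @bilinear_isBilinear.Build R[i] ell2 ell2 R[i]
  *%R (Num.conj \; *%R) ell2_dot (ell2_dot_linearl, ell2_dot_linearr).

Fact ell2_dot_hermitian (x y : ell2) :
  ell2_dot x y = (-1) ^+ false * (ell2_dot y x)^*.
Proof. by rewrite mul1r ell2_dot_conj. Qed.

HB.instance Definition _ := isHermitianSesquilinear.Build R[i] ell2 false
  Num.conj ell2_dot ell2_dot_hermitian.

HB.instance Definition _ := isDotProduct.Build R[i] ell2 ell2_dot ell2_dot_gt0.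

End Ell2.
Arguments ell2P {R} x [t] _.

(* The norm of a space with inner product [dot], as a real number. *)
Definition dotnorm (R : realType) (H : lmodType R[i])
  (dot : {dot H for Num.conj}) (x : H) : R := Num.sqrt (complex.Re (dot x x)).

(* The supremum is taken in R: it is meaningful for bounded operators, and is 0
   by convention if the set is not bounded above. *)
Definition numerical_radius (R : realType) (H : lmodType R[i])
    (dot : {dot H for Num.conj}) (T : {linear H -> H}) : R :=
  sup [set normc (dot (T x) x) | x in [set x | dotnorm dot x = 1]].

Section WeightedShift.
Variable R : realType.

Record ellinf := EllInf {
  seq_of_ellinf :> nat -> R[i]^o;
  ellinfP : bounded_fun seq_of_ellinf }.

Lemma ellinf_normc_bounded (a : ellinf) : exists M : R, forall k, normc (a k) <= M.
Proof.
have [M [Mreal aM]] := ellinfP a.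
have M1 : M < M + 1 by rewrite ltrDl.
have M1real : M + 1 \is Num.real by rewrite realD ?real1.
exists (complex.Re (M + 1)) => k.
rewrite -lecR (RRe_real M1real); exact: (aM _ M1 k I).
Qed.

Definition shift_seq (a x : nat -> R[i]^o) : nat -> R[i]^o :=
  fun k => if k is j.+1 then (a j : R[i]) * x j else 0.

Lemma shift_seq_ell2 (a : ellinf) (x : ell2 R) : shift_seq a x \in @ell2_pred R.
Proof.
apply/ell2_predP; have [M aM] := ellinf_normc_bounded a.
have gE : [sequence series (fun k => normc (shift_seq a x k) ^+ 2) n.+1]_n =
    series (fun k => normc ((a k : R[i]) * x k) ^+ 2).
  apply/funext => n; rewrite /= !seriesEnat/= big_nat_recl//=.
  by rewrite expr0n/= addr0 sqrtr0 expr0n/= add0r.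
suff cg : cvgn (series (fun k => normc ((a k : R[i]) * x k) ^+ 2)).
  by apply: cvgP; rewrite -cvg_shiftS gE; exact: cg.
apply: (@series_le_cvg _ _ (M ^+ 2 *: (fun k => normc (x k) ^+ 2) : nat -> R)).
- by move=> n; exact: sqr_ge0.
- by move=> n; apply: mulr_ge0; [exact: sqr_ge0|exact: sqr_ge0].
- move=> n; rewrite normcM exprMn; apply: ler_wpM2r.
    exact: sqr_ge0.
  rewrite ler_pXn2r ?nnegrE ?normc_ge0//.
  by apply: le_trans (aM n); exact: normc_ge0.
- exact: is_cvg_seriesZ (ell2P x).
Qed.

Definition weighted_shift (a : ellinf) (x : ell2 R) : ell2 R :=
  Ell2 (shift_seq_ell2 a x).

Fact weighted_shift_linear (a : ellinf) : linear (weighted_shift a).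
Proof.
move=> c x y; apply/val_inj/funext => -[|k] /=.
  by apply/esym; rewrite -[LHS]/(c * 0 + 0 : R[i]) mulr0 addr0.
rewrite -[LHS]/((a k : R[i]) * (c * x k + y k)).
by rewrite -[RHS]/(c * (a k * x k) + a k * y k :> R[i]) mulrDr mulrCA.
Qed.

HB.instance Definition _ (a : ellinf) :=
  GRing.isLinear.Build R[i] (ell2 R) (ell2 R) *:%R (weighted_shift a)
    (weighted_shift_linear a).

Definition wnorm (a : ellinf) : R :=
  numerical_radius (@ell2_dot R) (weighted_shift a).

End WeightedShift.

Definition modulus (R : realType) (a : nat -> R[i]) : nat -> R :=
  fun k => normc (a k).

Definition periodic_seq (T : Type) (N : nat) (b : nat -> T) : Prop :=
  (0 < N)%N /\ forall k, b (k + N)%N = b k.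

Definition period_mean (K : numFieldType) (N : nat) (b : nat -> K) : K :=
  N%:R^-1 * \sum_(k < N) b k.

(* Main.v *)
Require Import Defs.
From mathcomp Require Import all_boot all_order all_algebra.
From mathcomp Require Import complex.
From mathcomp Require Import all_classical all_reals all_analysis.
From mathcomp Require Import ring lra.
Set Implicit Arguments.
Unset Strict Implicit.
Unset Printing Implicit Defensive.
Import Order.TTheory GRing.Theory Num.Theory.
Import numFieldNormedType.Exports.
Import ComplexField Normc.
Local Open Scope classical_set_scope.
Local Open Scope ring_scope.

(** The numerical radius is tested on flat vectors. Take [x] with entries
    [u_k / sqrt (n + 1)] for [k <= n] and 0 beyond, where every [u_k] has
    modulus 1. It is a unit vector, and
      [<T_a x, x> = (n + 1)^-1 * \sum_(k < n) a_k u_k (u_{k+1})^*].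
    Choosing [u_{k+1}] as [u_k] times the phase of [a_k] makes each summand equal
    to [|a_k|], so [\sum_(k < n) |a_k| <= (n + 1) * w(T_a)]
    ([modulus_sum_le_wnorm]). The supremum in the numerical radius is taken over
    a bounded set since [T_a] is bounded ([numerical_range_shift_bounded]).

    Dividing by [n] and letting [n] grow bounds every limit of Cesaro means of
    [|a|] by [w(T_a)], and the same holds for any real sequence [b] with
    [b <= |a| + d] where [d] tends to 0 ([mean_limit_le_wnorm]). A convergent
    sequence has its limit as Cesaro limit, a periodic one its period mean
    ([cvg_arithmetic_mean_periodic]), which settles the claims about [|a|]. For
    [a = a1 + a2] with [a1] periodic and [a2] tending to [l], take
    [b = |a1 + l|], which is periodic and at most [|a| + |l - a2|]; the modulus
    of the mean of [a1 + l] is at most the mean of [b]. *)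

Section Modulus.
Variable R : realType.
Implicit Types z : R[i].

Lemma normc_sum (I : Type) (r : seq I) (P : pred I) (F : I -> R[i]) :
  normc (\sum_(i <- r | P i) F i) <= \sum_(i <- r | P i) normc (F i).
Proof.
elim/big_rec2: _ => [|i y x _ le_xy]; first by rewrite normc0.
by apply: le_trans (ler_normcD _ _) _; rewrite lerD2l.
Qed.

Lemma normc_lim_le (u : nat -> R[i]^o) z (B : R) :
  u @ \oo --> (z : R[i]^o) -> (forall n, normc (u n) <= B) -> normc z <= B.
Proof.
move=> /cvg_normcP uz uB; apply/ler_addgt0Pr => e /uz [n _ /(_ n (leqnn n)) zn].
rewrite -(subrK (u n) z) addrC.
by apply: le_trans (ler_normcD _ _) _; apply: lerD (uB n) (ltW zn).
Qed.

(** The value at 0 is 1 rather than 0, so that a phase always has modulus 1. *)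
Definition phase z : R[i] := if z == 0 then 1 else z / (normc z)%:C%C.

Lemma normc_real (r : R) : 0 <= r -> normc r%:C%C = r.
Proof. by move=> r0; rewrite /= expr0n /= addr0 sqrtr_sqr ger0_norm. Qed.

Lemma mulc_phaseJ z : z * (phase z)^* = (normc z)%:C%C.
Proof.
rewrite /phase; have [->|z0] := eqVneq z 0; first by rewrite mul0r normc0.
rewrite rmorphM /= mulrA mulcJ.
have n0 : normc z != 0 by rewrite normc_eq0.
have -> : (((normc z)%:C)%C^-1)^* = ((normc z)^-1)%:C%C :> R[i].
  by rewrite -fmorphV; exact: conjc_real.
by rewrite -rmorphM expr2 mulfK.
Qed.

Lemma phase_unit z : phase z * (phase z)^* = 1.
Proof.
rewrite {1}/phase; case: ifP => [/eqP ->|/negbT z0].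
  by rewrite /phase eqxx mul1r rmorph1.
by rewrite mulrAC mulc_phaseJ mulfV // fmorph_eq0 normc_eq0.
Qed.

(** Solves the recurrence for unimodular [u] that makes each term
    [a_k u_k (u_{k+1})^*] of the quadratic form of the shift real and
    nonnegative; such a [u] exists because the indices form a chain, so every
    phase of [a] can be absorbed into the next entry of [u]. *)
Fixpoint cumulative_phase (a : nat -> R[i]) k : R[i] :=
  if k is j.+1 then cumulative_phase a j * phase (a j) else 1.

Lemma cumulative_phase_unit a k : cumulative_phase a k * (cumulative_phase a k)^* = 1.
Proof.
elim: k => [|k IHk] /=; first by rewrite mul1r rmorph1.
by rewrite rmorphM /= mulrACA IHk phase_unit mulr1.
Qed.

Lemma cumulative_phaseS a k :
  a k * cumulative_phase a k * (cumulative_phase a k.+1)^* = (normc (a k))%:C%C.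
Proof.
rewrite /= rmorphM /= [a k * _]mulrC mulrACA cumulative_phase_unit mul1r.
exact: mulc_phaseJ.
Qed.

End Modulus.

Section FiniteSupport.
Variable R : realType.

Lemma finite_support_ell2 (n : nat) (x : nat -> R[i]^o) :
  (forall k, (n <= k)%N -> x k = 0) -> x \in @ell2_pred R.
Proof.
move=> x0; apply/ell2_predP; rewrite /square_summable.
apply: (@cvgP _ _ (series (fun k => normc (x k) ^+ 2) n)).
apply: cvg_near_cst; exists n => // m /= nm.
rewrite !seriesEnat /= (big_cat_nat _ nm) //= [X in _ + X]big_nat [X in _ + X]big1 ?addr0 // => k /andP[nk _].
by rewrite x0 // normc0 expr0n.
Qed.

Lemma ell2_dot_finite (n : nat) (x y : ell2 R) :
  (forall k, (n <= k)%N -> y k = 0) ->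
  ell2_dot x y = \sum_(k < n) (x k : R[i]) * (y k : R[i])^*.
Proof.
move=> y0; apply: (@lim_near_cst R[i]^o); first exact: norm_hausdorff.
exists n => // m /= nm.
rewrite seriesEnat /= (big_cat_nat _ nm) //= [X in _ + X]big_nat [X in _ + X]big1 ?addr0.
  by rewrite big_mkord.
by move=> k /andP[nk _]; rewrite y0 // rmorph0 mulr0.
Qed.

(** Links the abstract norm [dotnorm], defined through a complex limit, to the
    real series of squared moduli. *)
Lemma ell2_dotxx (x : ell2 R) :
  ell2_dot x x = (limn (series (fun k => normc (x k) ^+ 2)))%:C%C.
Proof.
apply: (@cvg_lim R[i]^o); first exact: norm_hausdorff.
apply: cvg_ReIm.
  apply: cvg_trans (ell2P x); apply: near_eq_cvg; apply: nearW => n.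
  by rewrite Re_series; congr (series _ n); apply/funext => k; rewrite mulcJ.
apply: cvg_near_cst; exists 0 => // n _ /=.
rewrite Im_series seriesEnat /= big1 // => k _; by rewrite mulcJ.
Qed.

Lemma series_le1_of_unit_dotnorm (x : ell2 R) n :
  dotnorm (@ell2_dot R) x = 1 -> series (fun k => normc (x k) ^+ 2) n <= 1.
Proof.
rewrite /dotnorm /= [X in complex.Re X]ell2_dotxx /= => x1.
apply: le_trans (nondecreasing_cvgn_le _ (ell2P x) n) _.
  by apply: nondecreasing_series => i _ _; exact: sqr_ge0.
set l := (X in Num.sqrt X) in x1 *.
by rewrite -[leRHS](expr1n _ 2) -x1 sqr_sqrtr // leNgt; apply/negP => /ltW/ler0_sqrtr;
  rewrite x1 => /eqP; rewrite oner_eq0.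
Qed.

End FiniteSupport.

Section NumericalRadius.
Variable R : realType.
Implicit Types a : ellinf R.

(** Without this bound the supremum defining [wnorm a] would be 0 by convention.
    Any bound will do, hence the crude [p * q <= p ^+ 2 + q ^+ 2] in place of
    the sharp Cauchy-Schwarz inequality: if [M] bounds the moduli of [a] and [x]
    is a unit vector, then the squared norms of [T_a x] and [x] are at most
    [M ^+ 2] and 1. *)
Lemma numerical_range_shift_bounded a : exists B : R, forall x : ell2 R,
  dotnorm (@ell2_dot R) x = 1 -> normc (ell2_dot (weighted_shift a x) x) <= B.
Proof.
have [M aM] := ellinf_normc_bounded a; exists (M ^+ 2 + 1) => x x1.
apply: normc_lim_le (@is_cvg_ell2_dot _ (weighted_shift a x) x) _ => n.
rewrite seriesEnat; apply: le_trans (normc_sum _ _ _) _.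
apply: (@le_trans _ _ (\sum_(0 <= k < n)
  (normc (shift_seq a x k) ^+ 2 + normc (x k) ^+ 2))).
  apply: ler_sum => k _; rewrite normcM Defs.normcJ.
  by move: (normc_ge0 (x k)) (normc_ge0 (shift_seq a x k)) => *; nra.
rewrite big_split /= lerD //; last exact: series_le1_of_unit_dotnorm.
case: n => [|n]; first by rewrite big_geq // sqr_ge0.
rewrite big_nat_recl // [shift_seq a x 0]/= normc0 expr0n add0r -[leRHS]mulr1.
apply: le_trans (ler_wpM2l (sqr_ge0 M) (series_le1_of_unit_dotnorm n x1)).
rewrite seriesEnat /= mulr_sumr; apply: ler_sum => k _.
rewrite normcM exprMn ler_wpM2r ?sqr_ge0 //.
by move: (normc_ge0 (a k)) (aM k) => *; nra.
Qed.

Lemma normc_dot_le_wnorm a (x : ell2 R) :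
  dotnorm (@ell2_dot R) x = 1 ->
  normc (ell2_dot (weighted_shift a x) x) <= wnorm a.
Proof.
move=> x1; rewrite /wnorm /numerical_radius.
apply: ub_le_sup; last by exists x.
by have [B aB] := numerical_range_shift_bounded a; exists B => _ [y y1 <-]; exact: aB.
Qed.

(** The test vector is flat: it has [n.+1] entries of equal modulus
    [c = 1 / sqrt (n + 1)], and its phases turn [<T_a x, x>] into
    [c ^ 2 * \sum_(k < n) |a_k|]. The [n.+1] entries only meet [n] weights; this
    boundary loss is invisible after averaging. *)
Lemma modulus_sum_le_wnorm a n :
  \sum_(k < n) normc (a k) <= n.+1%:R * wnorm a.
Proof.
pose c : R := (Num.sqrt n.+1%:R)^-1.
have c2 : c * c = n.+1%:R^-1.
  by rewrite -expr2 exprVn sqr_sqrtr // ler0n.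
pose x k : R[i]^o :=
  if (k <= n)%N then c%:C%C * cumulative_phase a k : R[i] else 0.
have xfin k : (n.+1 <= k)%N -> x k = 0 by rewrite /x ltnNge; case: ifP.
pose X := Ell2 (finite_support_ell2 xfin).
have conj_c : (c%:C%C)^* = c%:C%C :> R[i] by exact: conjc_real.
have X1 : dotnorm (@ell2_dot R) X = 1.
  rewrite /dotnorm /= [X in complex.Re X](@ell2_dot_finite _ n.+1 _ X xfin).
  rewrite (eq_bigr (fun=> (n.+1%:R^-1)%:C%C)) => [|k _].
    rewrite sumr_const card_ord -rmorphMn /= -mulr_natr mulVf ?sqrtr1 //.
  rewrite /= /x -ltnS ltn_ord rmorphM /= conj_c mulrACA cumulative_phase_unit.
  by rewrite mulr1 -rmorphM c2.
have := normc_dot_le_wnorm a X1.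
rewrite (@ell2_dot_finite _ n.+1 _ X xfin) big_ord_recl /= mul0r add0r.
rewrite (eq_bigr (fun k : 'I_n => (n.+1%:R^-1 * normc (a k))%:C%C)) => [|k _].
  rewrite -rmorph_sum -mulr_sumr normc_real; last first.
    by rewrite mulr_ge0 ?invr_ge0 ?ler0n // sumr_ge0 // => k _; exact: normc_ge0.
  by rewrite mulrC ler_pdivrMr ?ltr0n // mulrC.
rewrite /x /= (ltnW (ltn_ord k)) /bump leq0n add1n ltn_ord rmorphM /= conj_c.
rewrite add0n [X in X * _]mulrCA mulrACA [X in _ * X](cumulative_phaseS a k).
by rewrite -!rmorphM c2.
Qed.

End NumericalRadius.

Section CesaroMeans.
Variable R : realType.

Lemma periodic_modn (T : Type) N (b : nat -> T) k :
  periodic_seq N b -> b (k %% N)%N = b k.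
Proof.
move=> [_ bN]; rewrite [in RHS](divn_eq k N) addnC.
elim: (k %/ N)%N => [|q IHq]; first by rewrite mul0n addn0.
by rewrite mulSn (addnC N) addnA bN.
Qed.

(** Subtracting the mean cancels the growth of the partial sums over a full
    period, so the deviations are periodic, hence bounded. *)
Lemma periodic_series_dev N (b : nat -> R) : periodic_seq N b ->
  periodic_seq N (fun n => series b n - n%:R * period_mean N b).
Proof.
move=> [N0 bN]; split=> // n; elim: n => [|n IHn].
  rewrite add0n mul0r subr0 !seriesEnat /= [in RHS]big_geq // big_mkord /period_mean.
  by rewrite mulrA mulfV ?mul1r ?subrr // pnatr_eq0 -lt0n.
have step m : series b m.+1 - m.+1%:R * period_mean N b =
    series b m - m%:R * period_mean N b + (b m - period_mean N b).
  by rewrite !seriesEnat /= big_nat_recr //= -natr1; ring.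
by rewrite addSn !step IHn bN.
Qed.

(** The mean of the first [n + 1] terms differs from the period mean by a bounded
    deviation divided by [n + 1]. *)
Lemma cvg_arithmetic_mean_periodic N (b : nat -> R) : periodic_seq N b ->
  arithmetic_mean b @ \oo --> period_mean N b.
Proof.
move=> bN; have := periodic_series_dev bN.
set m := period_mean N b; set c := (X in periodic_seq _ X) => cN.
pose M := \sum_(k < N) `|c k|.
have cM n : `|c n| <= M.
  rewrite -(periodic_modn n cN).
  have nN : (n %% N < N)%N by rewrite ltn_mod; case: bN.
  by rewrite /M (bigD1 (Ordinal nN)) //= lerDl sumr_ge0.
have mM (s : R) : (fun n => m + harmonic n * s) @ \oo --> m.
  rewrite -[X in _ --> X]addr0 -[X in _ + X](mul0r s).
  by apply: cvgD; [exact: cvg_cst|apply: cvgMl; exact: cvg_harmonic].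
apply: (squeeze_cvgr _ (mM (- M)) (mM M)); apply: nearW => n.
have -> : arithmetic_mean b n = m + harmonic n * c n.+1.
  rewrite /arithmetic_mean /harmonic /c /= mulrBr [X in _ - X]mulrA.
  by rewrite mulVf ?pnatr_eq0 // mul1r [RHS]addrC subrK.
have /andP[cl cr] : - M <= c n.+1 <= M by rewrite -ler_norml.
by rewrite !lerD2l !ler_wpM2l // harmonic_ge0.
Qed.

Lemma arithmetic_mean_le_wnorm (a : ellinf R) n :
  arithmetic_mean (modulus a) n <= wnorm a + harmonic n * wnorm a.
Proof.
rewrite /arithmetic_mean /harmonic /= seriesEnat /= big_mkord.
rewrite ler_pdivrMl ?ltr0n //; apply: le_trans (modulus_sum_le_wnorm a n.+1) _.
by rewrite mulrDr mulrA mulfV ?pnatr_eq0 // -natr1 mulrDl !mul1r.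
Qed.

(** A perturbation [d] tending to 0 has Cesaro means tending to 0, so it does not
    affect the bound obtained by averaging. Allowing it covers, in one
    statement, moduli that converge in mean and asymptotically periodic weights. *)
Lemma mean_limit_le_wnorm (a : ellinf R) (b d : nat -> R) m :
  arithmetic_mean b @ \oo --> m -> d @ \oo --> 0 ->
  (forall k, b k <= modulus a k + d k) -> m <= wnorm a.
Proof.
move=> bm /cesaro d0 bad.
have rhs : (fun n => wnorm a + harmonic n * wnorm a + arithmetic_mean d n) @ \oo
    --> wnorm a + 0 * wnorm a + 0.
  apply: cvgD d0; apply: cvgD; first exact: cvg_cst.
  by apply: cvgMl; exact: cvg_harmonic.
rewrite -[leRHS]addr0 -[X in _ <= X + _]addr0 -[X in _ <= _ + X + _](mul0r (wnorm a)).
apply: ler_cvg_to bm rhs _; apply: nearW => n.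
apply: le_trans (lerD (arithmetic_mean_le_wnorm a n) (lexx _)).
rewrite /arithmetic_mean /= -mulrDr ler_wpM2l ?invr_ge0 ?ler0n //.
by rewrite !seriesEnat /= -big_split; apply: ler_sum => k _; exact: bad.
Qed.

End CesaroMeans.

Theorem corollary2p4 (R : realType) (a : ellinf R) :
  [/\ (* (a) *)
      cvgn (arithmetic_mean (modulus a)) ->
        limn (arithmetic_mean (modulus a)) <= wnorm a,
      (* (b) *)
      cvgn (modulus a) -> limn (modulus a) <= wnorm a,
      (* (c) *)
      forall N : nat, periodic_seq N a -> period_mean N (modulus a) <= wnorm a &
      (* (d) *)
      forall (N : nat) (a1 : ellinf R) (a2 : nat -> R[i]^o),
        periodic_seq N a1 -> cvgn a2 -> (forall k, a k = a1 k + a2 k) ->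
        normc (@period_mean R[i] N a1 + limn a2) <= wnorm a].
Proof.
have d0 : (fun=> 0 : R) @ \oo --> (0 : R) by exact: cvg_cst.
have mean_le (m : R) : arithmetic_mean (modulus a) @ \oo --> m -> m <= wnorm a.
  by move=> am; apply: mean_limit_le_wnorm am d0 _ => k; rewrite addr0.
split.
- by move=> am; exact: mean_le.
- by move=> /cesaro; exact: mean_le.
- move=> N [N0 aN]; apply/mean_le/cvg_arithmetic_mean_periodic.
  by split=> // k; rewrite /modulus aN.
- move=> N a1 a2 [N0 a1N] a2cvg aE.
  (* The limit of [a2] is moved into the periodic part: the mean of [b]
     dominates the modulus in question, and [b] exceeds [|a|] by at most
     [|l - a2|]. *)
  set l := limn a2; pose b : nat -> R := fun k => normc (a1 k + l).
  have bN : periodic_seq N b by split=> // k; rewrite /b a1N.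
  have dist0 : (fun k => normc (l - a2 k)) @ \oo --> (0 : R).
    apply/cvgrPdist_lt => e /((cvg_normcP a2 l).1 a2cvg).
    by apply: filterS => k; rewrite sub0r normrN ger0_norm // normc_ge0.
  apply: (@le_trans _ _ (period_mean N b)); last first.
    apply: mean_limit_le_wnorm (cvg_arithmetic_mean_periodic bN) dist0 _ => k.
    rewrite /b /modulus aE; apply: le_trans (ler_normcD _ _).
    by rewrite -addrA [a2 k + _]addrC subrK.
  have -> : period_mean N a1 + l = N%:R^-1 * \sum_(k < N) (a1 k + l) :> R[i].
    rewrite big_split /= sumr_const card_ord mulrDr -[X in _ + _ * X]mulr_natl mulrA.
    by rewrite mulVf ?mul1r // pnatr_eq0 -lt0n.
  (* The mean of [b] is real, the mean of [a1] complex: align the scalars. *)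
  have -> : N%:R^-1 = (N%:R^-1)%:C%C :> R[i] by rewrite fmorphV rmorph_nat.
  rewrite normcM normc_real ?invr_ge0 ?ler0n // ler_wpM2l ?invr_ge0 ?ler0n //.
  exact: normc_sum.
Qed.
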